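(* Let $s\ge1$, $n=2s$, and let $A$ be the $n\times n$ matrix with $A_{ij}=1$ if $|i-j|\le s-1$ and $A_{ij}=0$ otherwise. Label the eigenvalues of $A$ so that $|\lambda_1(A)|\ge|\lambda_2(A)|\ge\dots\ge|\lambda_n(A)|$. Then \[ |\lambda_2(A)|=\frac{1}{\sqrt{2+2\cos\left(\frac{2s\pi}{2s+1}\right)}}, \] with corresponding eigenvector $u=[u_j]$, where $u_j=\cos\left(\frac{(2j-1)\pi}{4s+2}\right)$ for $j=1,\dots,s$ and $u_j=-u_{n-j+1}$ for $j=s+1,\dots,n$.
   Context: $A$ is the symmetric banded 0/1 matrix of even order $n=2s$ whose first row has exactly $s$ entries equal to $1$ (the model matrix of the random linear graph is $p(A-I)$). *)

(* Defs.v *)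
From HB Require Import structures.
From mathcomp Require Import all_boot all_order all_algebra.
From mathcomp Require Import all_classical all_reals all_analysis.
Set Implicit Arguments. Unset Strict Implicit. Unset Printing Implicit Defensive.
Import Order.TTheory GRing.Theory Num.Theory.
Local Open Scope ring_scope.

(* Indices are 0-based: row/column i : 'I_n corresponds to the paper's i+1. *)

Definition bandA (R : ringType) (s : nat) : 'M[R]_(2 * s) :=
  \matrix_(i < 2 * s, j < 2 * s)
    (if (`|(i : int) - (j : int)|%N <= s.-1)%N then 1 else 0).

(* Paper's u_j = cos((2j-1)pi/(4s+2)) for j = 1..s, u_j = -u_{n-j+1} for j > s.
   With 0-based k = j - 1: for k < s, u = cos((2k+1)pi/(4s+2)); for k >= s,
   u_k = - u_{n-1-k}. *)
Definition u_half (R : realType) (s k : nat) : R :=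
  cos ((2 * k + 1)%:R * pi / (4 * s + 2)%:R).

Definition vecU (R : realType) (s : nat) : 'cV[R]_(2 * s) :=
  \col_(k < 2 * s)
    (if (k < s)%N then u_half R s k else - u_half R s (2 * s - 1 - k)).

(* Main.v *)
Require Import Defs.
From HB Require Import structures.
From mathcomp Require Import all_boot all_order all_algebra.
From mathcomp Require Import all_classical all_reals all_analysis.
From mathcomp Require Import spectral sesquilinear complex ring lra zify.
Set Implicit Arguments. Unset Strict Implicit. Unset Printing Implicit Defensive.
Import Order.TTheory GRing.Theory Num.Theory.
Local Open Scope ring_scope.

(** Write [A = J - B] with [J] the all-ones matrix, so that [B] is the 0/1
    matrix of the pairs with [|i - j| >= s]. Put [mu = 1 / (2 sin theta)] with
    [theta = pi / (4s + 2)]. Summing cosines in arithmetic progression shows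
    that the mirror-symmetric vector [w] with the same first half as [u] is a
    positive eigenvector of [B] for [mu], while [B u = - mu u]. As the entries
    of [u] add up to 0, [A u = mu u].

    Since [B] is nonnegative with a positive eigenvector for [mu], its quadratic
    form is bounded by [mu |x|^2] in absolute value. Hence [A >= - mu], because
    [J >= 0], and [A <= mu] on the orthogonal complement of the all-ones vector,
    so at most one eigenvalue of [A] exceeds [mu]. Conversely [A >= mu] on the
    plane spanned by the orthogonal vectors [u] and [w], so at least two
    eigenvalues are [>= mu]. Therefore [mu] is the second eigenvalue in absolute
    value. *)

(** * Eigenvalues of a Hermitian matrix and its quadratic form *)

Section HermitianSpectrum.
Local Open Scope sesquilinear_scope.
Variables (C : numClosedFieldType) (n : nat) (A : 'M[C]_n).
Hypothesis Aherm : A \is hermsymmx.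

Let P := spectralmx A.
Let d := spectral_diag A.

Let Punitary : P \is unitarymx. Proof. exact: spectral_unitarymx. Qed.

Let AE : A = P ^t* *m diag_mx d *m P.
Proof.
by rewrite -invmx_unitary//; exact/orthomx_spectralP/hermitian_normalmx.
Qed.

(** Conjugation by [P] turns ['X - A] into a diagonal matrix without changing the determinant. *)
Lemma char_poly_spectral_diag :
  char_poly A = \prod_i ('X - (spectral_diag A 0 i)%:P).
Proof.
pose f := map_mx (@polyC C).
have Punit : P \in unitmx by exact: unitarymx_unit.
have fK : f _ _ (invmx P) *m f _ _ P = 1%:M.
  by rewrite /f -map_mxM mulVmx// map_mx1.
have -> : char_poly A = char_poly (diag_mx d).
  rewrite /char_poly /char_poly_mx {1}AE -invmx_unitary//.
  have -> : 'X%:M - map_mx (@polyC C) (invmx P *m diag_mx d *m P) =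
            f _ _ (invmx P) *m ('X%:M - f _ _ (diag_mx d)) *m f _ _ P.
    by rewrite mulmxBr mulmxBl scalar_mxC -[_ *m f _ _ P]mulmxA fK mulmx1 /f !map_mxM.
  by rewrite !det_mulmx mulrAC -det_mulmx fK det1 mul1r.
rewrite char_poly_trig ?diag_mx_is_trig//.
by apply: eq_bigr => i _; rewrite mxE eqxx mulr1n.
Qed.

(** The rows of [P] form an orthonormal eigenbasis, in which [x] has the coordinates
    [x *m P ^t*]. *)
Lemma hermitian_quadE (x : 'rV[C]_n) :
  (x *m A *m x ^t*) 0 0 =
  \sum_i spectral_diag A 0 i * `|(x *m spectralmx A ^t*) 0 i| ^+ 2.
Proof.
rewrite {1}AE !mulmxA -[_ *m P *m _]mulmxA.
have -> : P *m x ^t* = (x *m P ^t*) ^t*.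
  by rewrite trmx_mul map_mxM trmxCK.
rewrite mul_mx_diag mxE; apply: eq_bigr => i _.
by rewrite !mxE normCK mulrAC mulrC.
Qed.

Lemma hermitian_normE (x : 'rV[C]_n) :
  (x *m x ^t*) 0 0 = \sum_i `|(x *m spectralmx A ^t*) 0 i| ^+ 2.
Proof.
rewrite -[in LHS](mulmxKtV x Punitary)//.
rewrite -/P trmx_mul map_mxM mulmxA mulmxtVK// mxE.
by apply: eq_bigr => i _; rewrite !mxE normCK.
Qed.

(** It suffices to test the form on row [i] of [P], a unit eigenvector. *)
Lemma spectral_diag_ge (mu : C) (i : 'I_n) :
  (forall x : 'rV[C]_n, mu * (x *m x ^t*) 0 0 <= (x *m A *m x ^t*) 0 0) ->
  mu <= spectral_diag A 0 i.
Proof.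
move=> /(_ (delta_mx 0 i *m P)).
rewrite hermitian_normE hermitian_quadE -/P mulmxtVK//.
have y0 j : j != i -> `|(delta_mx 0 i : 'rV[C]_n) 0 j| ^+ 2 = 0.
  by move=> ji; rewrite mxE (negPf ji) andbF normr0 expr0n.
rewrite (bigD1 i)//= [\sum_(_ | _) _]big1//.
rewrite [X in _ <= X](bigD1 i)//= [\sum_(_ | _) _]big1 => [|j /y0->]; last first.
  by rewrite mulr0.
by rewrite mxE !eqxx normr1 expr1n !addr0 !mulr1.
Qed.

(** If all eigenvalues but the [i]-th were below [mu], the form of [mu - A] at [x] would be a sum of
    nonnegative terms with total at most 0; every coordinate of [x] would then vanish. *)
Lemma spectral_diag_exists_ge (mu : C) (x : 'rV[C]_n) (i : 'I_n) :
    mu \is Num.real -> x != 0 -> (x *m spectralmx A ^t*) 0 i = 0 ->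
    mu * (x *m x ^t*) 0 0 <= (x *m A *m x ^t*) 0 0 ->
  exists2 j, j != i & mu <= spectral_diag A 0 j.
Proof.
move=> mu_real x0 xi; rewrite hermitian_normE hermitian_quadE mulr_sumr.
move=> le_sum; apply: contrapT => /forall2NP dlt.
have {}dlt j : j != i -> d 0 j < mu.
  move=> ji; have dj : d 0 j \is Num.real.
    exact: (mxOverP (hermitian_spectral_diag_real Aherm)).
  by have [//|/negP] := dlt j; rewrite -real_ltNge.
move/negP: x0; apply; apply/eqP.
rewrite -(mulmxKtV x Punitary)//.
suff -> : x *m P ^t* = 0 by rewrite mul0mx.
apply/rowP => j; rewrite [RHS]mxE; apply/eqP.
have term_ge0 k : true -> 0 <= (mu - d 0 k) * `|(x *m P ^t*) 0 k| ^+ 2.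
  move=> _; have [->|ki] := eqVneq k i.
    by rewrite xi normr0 expr0n mulr0.
  by rewrite mulr_ge0 ?exprn_ge0// subr_ge0 ltW ?dlt.
have : \sum_k (mu - d 0 k) * `|(x *m P ^t*) 0 k| ^+ 2 == 0.
  rewrite eq_le sumr_ge0// andbT.
  under eq_bigr do rewrite mulrBl.
  by rewrite big_split/= sumrN subr_le0.
rewrite psumr_eq0// => /allP/(_ j (mem_index_enum _))/=.
have [->|ji] := eqVneq j i; first by rewrite xi eqxx.
by rewrite mulf_eq0 subr_eq0 gt_eqF ?dlt//= sqrf_eq0 normr_eq0.
Qed.

(** Eigenvectors for two eigenvalues above [mu] would span a plane where the form exceeds [mu |x|^2]
    at every nonzero [x], yet that plane contains a nonzero solution of [x *m v = 0]. *)
Lemma spectral_diag_pair_le (mu : C) (v : 'cV[C]_n) (i j : 'I_n) :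
    mu \is Num.real -> i != j ->
    (forall x : 'rV[C]_n, x *m v = 0 ->
       (x *m A *m x ^t*) 0 0 <= mu * (x *m x ^t*) 0 0) ->
  (spectral_diag A 0 i <= mu) || (spectral_diag A 0 j <= mu).
Proof.
move=> mu_real ij Ale.
have d_real k : d 0 k \is Num.real.
  exact: (mxOverP (hermitian_spectral_diag_real Aherm)).
rewrite -[_ || _]negbK negb_or -!real_ltNge//; apply/negP => /andP[ltdi ltdj].
(* For [a p + b q = 0], take [(1, 0)] if [p = 0] and [(q, - p)] otherwise. *)
have [a [b [ab0 abv]]] : exists a b : C, (a, b) != (0, 0) /\
    a * (P *m v) i 0 + b * (P *m v) j 0 = 0.
  have [Pi0|Pi0] := eqVneq ((P *m v) i 0) 0.
    exists 1, 0; rewrite Pi0 mulr0 mul0r addr0; split => //.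
    by rewrite xpair_eqE oner_eq0.
  exists ((P *m v) j 0), (- (P *m v) i 0); split.
    by rewrite xpair_eqE oppr_eq0 (negPf Pi0) andbF.
  by rewrite mulrC mulNr subrr.
pose y : 'rV[C]_n := a *: delta_mx 0 i + b *: delta_mx 0 j.
have yE k : y 0 k = a *+ (k == i) + b *+ (k == j).
  by rewrite !mxE eqxx !mulr_natr.
have sumE (F : 'I_n -> C) : \sum_k F k * `|y 0 k| ^+ 2 =
    F i * `|a| ^+ 2 + F j * `|b| ^+ 2.
  rewrite (bigD1 i)//= (bigD1 j) 1?eq_sym//= big1 => [|k /andP[ki kj]].
    by rewrite !yE !eqxx (negPf ij) eq_sym (negPf ij) add0r !addr0.
  by rewrite yE (negPf ki) (negPf kj) addr0 normr0 expr0n mulr0.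
have := Ale (y *m P); rewrite hermitian_quadE hermitian_normE mulr_sumr -/P -/d.
rewrite mulmxtVK// !sumE => /(_ _)/wrap[].
  rewrite -mulmxA; apply/matrixP => k l; rewrite !ord1 [RHS]mxE mulmxDl.
  by rewrite -!scalemxAl -!rowE !mxE in abv *.
rewrite -subr_le0 opprD addrACA -!mulrBl lt_geF//.
have ge0 (c e : C) : mu < e -> 0 <= (e - mu) * `|c| ^+ 2.
  by move=> lte; rewrite mulr_ge0 ?exprn_ge0 ?normr_ge0// subr_ge0 ltW.
have gt0 (c e : C) : mu < e -> c != 0 -> 0 < (e - mu) * `|c| ^+ 2.
  by move=> lte c0; rewrite mulr_gt0 ?subr_gt0// exprn_gt0 ?normr_gt0.
have [a0|a0] := eqVneq a 0; last by rewrite ltr_pwDl ?gt0 ?ge0.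
by rewrite ltr_wpDl ?gt0 ?ge0//; move: ab0; rewrite a0 xpair_eqE eqxx.
Qed.

End HermitianSpectrum.

(** * Quadratic form of a nonnegative matrix with a positive eigenvector *)

Section NonnegativeQuadraticForm.
Local Open Scope sesquilinear_scope.
Variables (C : numClosedFieldType) (n : nat) (B : 'M[C]_n).
Variables (w : 'cV[C]_n) (mu : C).
Hypotheses (Bsym : B^T = B) (B_ge0 : forall i j, 0 <= B i j).
Hypotheses (w_gt0 : forall i, 0 < w i 0) (Bw : B *m w = mu *: w).

(* AM-GM with weights [w j / w i]; the diagonal part then collapses by [Bw]. *)
Let nonneg_quad_aux (e : C) (x : 'rV[C]_n) : e \is Num.real -> e ^+ 2 = 1 ->
  0 <= mu * (x *m x ^t*) 0 0 + e * (x *m B *m x ^t*) 0 0.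
Proof.
move=> e_real e2; have eJ : e^* = e by exact/CrealP.
have wJ i : (w i 0)^* = w i 0 by exact/CrealP/gtr0_real.
(* Expanding the square gives two diagonal terms [D] and two cross terms [E]. The sign [e = 1]
   yields the lower bound on the form, [e = -1] the upper one. *)
pose T i j := B i j * `|x 0 i * w j 0 + e * (x 0 j * w i 0)| ^+ 2
  / (w i 0 * w j 0).
have T_ge0 : 0 <= \sum_i \sum_j T i j.
  do 2 (apply: sumr_ge0 => ? _).
  by rewrite divr_ge0 ?mulr_ge0 ?exprn_ge0// ltW.
pose D i j := B i j * w j 0 / w i 0 * `|x 0 i| ^+ 2.
pose E i j := e * (x 0 i * B i j * (x 0 j)^*).
have TE i j : T i j = (D i j + D j i) + (E i j + E j i).
  have Bji : B j i = B i j by rewrite -{1}Bsym mxE.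
  have w0 k : w k 0 != 0 by rewrite gt_eqF.
  rewrite /T /D /E !normCK !(rmorphD, rmorphM)/= !wJ eJ Bji.
  (* The factor [e ^+ 2] stays explicit so that this is a field identity in a free [e]; it becomes 1
     afterwards. *)
  transitivity (B i j * w j 0 / w i 0 * (x 0 i * (x 0 i)^*) +
     e ^+ 2 * (B i j * w i 0 / w j 0 * (x 0 j * (x 0 j)^*)) +
     (e * (x 0 i * B i j * (x 0 j)^*) + e * (x 0 j * B i j * (x 0 i)^*))).
    by field; rewrite !w0.
  by rewrite e2 mul1r.
have sumD : \sum_i \sum_j D i j = mu * (x *m x ^t*) 0 0.
  rewrite mxE mulr_sumr; apply: eq_bigr => i _.
  rewrite -mulr_suml -mulr_suml.
  have -> : \sum_j B i j * w j 0 = mu * w i 0.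
    by have /colP/(_ i) := Bw; rewrite !mxE.
  by rewrite mulfK ?gt_eqF// !mxE normCK.
have sumE : \sum_i \sum_j E i j = e * (x *m B *m x ^t*) 0 0.
  rewrite mxE exchange_big mulr_sumr; apply: eq_bigr => j _ /=.
  by rewrite !mxE mulr_suml mulr_sumr.
have sumT (F : 'I_n -> 'I_n -> C) :
    \sum_i \sum_j (F i j + F j i) = (\sum_i \sum_j F i j) *+ 2.
  under eq_bigr do rewrite big_split/=.
  by rewrite big_split/= [X in _ + X]exchange_big mulr2n.
move: T_ge0; under eq_bigr do under eq_bigr do rewrite TE.
under eq_bigr do rewrite big_split/=.
by rewrite big_split/= !sumT -mulrnDl sumD sumE pmulrn_lge0.
Qed.

Lemma nonneg_quad_le (x : 'rV[C]_n) :
  (x *m B *m x ^t*) 0 0 <= mu * (x *m x ^t*) 0 0.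
Proof.
have := @nonneg_quad_aux (-1) x; rewrite mulN1r subr_ge0; apply.
  by rewrite realN real1.
by rewrite sqrrN expr1n.
Qed.

Lemma nonneg_quad_ge (x : 'rV[C]_n) :
  - mu * (x *m x ^t*) 0 0 <= (x *m B *m x ^t*) 0 0.
Proof.
have := @nonneg_quad_aux 1 x (real1 _) (expr1n _ _).
by rewrite mul1r mulNr => ?; rewrite lerNl -subr_ge0 opprK.
Qed.

End NonnegativeQuadraticForm.

(** * Ordering a spectrum by absolute value *)

(** All values but a largest one [d i0] are at most [mu], and some other value [d i1] is at least
    [mu], hence equal to it. The list starts with these two; the rest lies in [[- mu, mu]]. *)
Lemma spectrum_arrangement (R : realDomainType) (n : nat) (d : 'I_n -> R)
    (mu : R) : (0 < n)%N ->
    (forall i, - mu <= d i) ->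
    (forall i j, i != j -> (d i <= mu) || (d j <= mu)) ->
    (forall i, exists2 j, j != i & mu <= d j) ->
  exists rs : seq R, [/\ size rs = n,
    perm_eq rs [seq d i | i <- enum 'I_n],
    sorted (fun x y => `|y| <= `|x|) rs & rs`_1 = mu].
Proof.
move=> n_gt0 d_ge d_pair d_two.
pose i0 := [arg max_(i > Ordinal n_gt0) d i]%O.
have d_max j : d j <= d i0 by rewrite /i0; case: arg_maxP => // i _; apply.
have d_le j : j != i0 -> d j <= mu.
  by move=> /d_pair/orP[//|]; apply: le_trans.
have [i1 i10 mu_le] := d_two i0.
have d1 : d i1 = mu by apply/eqP; rewrite eq_le d_le.
pose leT (x y : R) := `|y| <= `|x|.
have leT_total : total leT by move=> x y; exact: le_total.
have leT_trans : transitive leT by move=> x y z xy yz; exact: le_trans yz xy.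
pose s := [seq d i | i <- rem i1 (rem i0 (enum 'I_n))].
have enumE : perm_eq (enum 'I_n) [:: i0, i1 & rem i1 (rem i0 (enum 'I_n))].
  apply: perm_trans (perm_to_rem (mem_enum _ i0)) _.
  by rewrite perm_cons perm_to_rem// mem_rem_uniq ?enum_uniq// !inE i10 mem_enum.
have rsP : perm_eq [:: d i0, d i1 & sort leT s] [seq d i | i <- enum 'I_n].
  rewrite perm_sym; apply: perm_trans (perm_map d enumE) _.
  by rewrite /= !perm_cons perm_sym perm_sort.
exists [:: d i0, d i1 & sort leT s]; split=> //.
  by rewrite (perm_size rsP) size_map size_enum_ord.
have mu_ge0 : 0 <= mu by have := le_trans (d_ge i1) (d_le _ i10); lra.
rewrite /= -/(leT _ _); apply/andP; split.
  by rewrite d1 /leT !ger0_norm// ?(le_trans mu_ge0)// (le_trans mu_le).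
rewrite path_sortedE//; apply/andP; split; last exact: sort_sorted.
rewrite all_sort all_map; apply/allP => j /=; rewrite d1.
rewrite mem_rem_uniq ?rem_uniq ?enum_uniq// => /andP[_].
rewrite mem_rem_uniq ?enum_uniq// => /andP[j0 _].
by rewrite /leT (ger0_norm mu_ge0) ler_norml d_ge d_le.
Qed.

(** * Spectrum of the all-ones matrix minus a nonnegative matrix *)

Section OnesMinusNonnegative.
Local Open Scope sesquilinear_scope.
Local Open Scope complex_scope.
Variables (R : rcfType) (n : nat) (B : 'M[R]_n) (w u : 'cV[R]_n) (mu : R).
Hypotheses (mu_gt0 : 0 < mu) (Bsym : B^T = B) (B_ge0 : forall i j, 0 <= B i j).
Hypotheses (w_gt0 : forall i, 0 < w i 0) (Bw : B *m w = mu *: w).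
Hypotheses (u_neq0 : u != 0) (Bu : B *m u = - mu *: u) (u_sum0 : \sum_i u i 0 = 0).
Hypothesis w_half : forall i, 2 * mu * w i 0 <= \sum_j w j 0.

Let A : 'M[R]_n := const_mx 1 - B.
Let toC := real_complex R.
Let AC := map_mx toC A.
Let BC := map_mx toC B.
Let wC := map_mx toC w.
Let uC := map_mx toC u.

Let Au : A *m u = mu *: u.
Proof.
rewrite mulmxBl Bu scaleNr opprK -[RHS]add0r; congr (_ + _).
apply/colP => i; rewrite !mxE -[RHS]u_sum0.
by apply: eq_bigr => j _; rewrite mxE mul1r.
Qed.

Let Asym : A^T = A.
Proof. by rewrite linearB/= Bsym trmx_const. Qed.

(** Eigenvectors of the symmetric [B] for the distinct eigenvalues [- mu] and [mu] are
    orthogonal. *)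
Let uw0 : u^T *m w = 0.
Proof.
have : mu *: (u^T *m w) = - mu *: (u^T *m w).
  by rewrite scalemxAr -Bw mulmxA -{1}Bsym -trmx_mul Bu linearZ/= -scalemxAl.
move/eqP; rewrite scaleNr -subr_eq0 opprK -scalerDl scaler_eq0.
by rewrite gt_eqF ?addr_gt0//= => /eqP.
Qed.

(** Entry [i] of [A *m w] is the sum of [w] minus [mu * w i 0], which is at least [mu * w i 0] by
    [w_half]. *)
Let wAw : mu * (w^T *m w) 0 0 <= (w^T *m A *m w) 0 0.
Proof.
rewrite -mulmxA mulmxBl Bw !mxE mulr_sumr; apply: ler_sum => i _.
rewrite !mxE mulrCA ler_pM2l//.
under eq_bigr do rewrite mxE mul1r.
by have := w_half i; lra.
Qed.

Let toC_real x : toC x \is Num.real.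
Proof. by apply/complex_realP; exists x. Qed.

Let AC_herm : AC \is hermsymmx.
Proof.
apply: realsym_hermsym.
  by apply/is_hermitianmxP; rewrite expr0 scale1r map_mx_id// map_trmx Asym.
by apply/mxOverP => i j; rewrite mxE.
Qed.

Let BC_sym : BC^T = BC.
Proof. by rewrite map_trmx Bsym. Qed.

Let BC_ge0 i j : 0 <= BC i j.
Proof. by rewrite mxE lecR. Qed.

Let wC_gt0 i : 0 < wC i 0.
Proof. by rewrite mxE ltcR. Qed.

Let BCwC : BC *m wC = mu%:C *: wC.
Proof. by rewrite -map_mxM Bw map_mxZ. Qed.

Let ACuC : AC *m uC = mu%:C *: uC.
Proof. by rewrite -map_mxM Au map_mxZ. Qed.

Let onesC : 'cV[R[i]]_n := const_mx 1.

(** The all-ones matrix has rank one, so its form is a single square. *)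
Let AC_quadE (x : 'rV[R[i]]_n) : (x *m AC *m x ^t*) 0 0 =
  `|(x *m onesC) 0 0| ^+ 2 - (x *m BC *m x ^t*) 0 0.
Proof.
have -> : AC = onesC *m onesC ^t* - BC.
  apply/matrixP => i j; rewrite !(mxE, big_ord1) conjC1 mulr1.
  by rewrite /toC rmorphB rmorph1.
rewrite mulmxBr mulmxBl [LHS]mxE; congr (_ + _); last by rewrite mxE.
rewrite mulmxA -mulmxA.
have -> : onesC ^t* *m x ^t* = (x *m onesC) ^t* by rewrite trmx_mul map_mxM.
by rewrite !(mxE, big_ord1) normCK.
Qed.

Let AC_ge i : - mu%:C <= spectral_diag AC 0 i.
Proof.
apply: spectral_diag_ge => // x; rewrite AC_quadE.
have := nonneg_quad_le BC_sym BC_ge0 wC_gt0 BCwC x => le_mu.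
by rewrite mulNr ler_wpDl ?exprn_ge0 ?lerN2.
Qed.

Let AC_pair i j : i != j ->
  (spectral_diag AC 0 i <= mu%:C) || (spectral_diag AC 0 j <= mu%:C).
Proof.
move=> ij; apply: (spectral_diag_pair_le AC_herm (v := onesC)) => // x x1.
rewrite AC_quadE x1 mxE normr0 expr0n add0r.
have := nonneg_quad_ge BC_sym BC_ge0 wC_gt0 BCwC x.
by rewrite lerNl mulNr.
Qed.

(** The plane spanned by [u] and [w] contains a nonzero [x] without component along the [i]-th
    eigenvector. Orthogonality and [A u = mu u] remove the cross terms from the norm and the form of
    [x]. *)
Let AC_two i : exists2 j, j != i & mu%:C <= spectral_diag AC 0 j.
Proof.
set P := spectralmx AC.
have [a [b [ab0 abP]]] : exists a b : R[i], (a, b) != (0, 0) /\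
    a * (uC^T *m P ^t*) 0 i + b * (wC^T *m P ^t*) 0 i = 0.
  have [Pi0|Pi0] := eqVneq ((uC^T *m P ^t*) 0 i) 0.
    exists 1, 0; rewrite Pi0 mulr0 mul0r addr0; split => //.
    by rewrite xpair_eqE oner_eq0.
  exists ((wC^T *m P ^t*) 0 i), (- (uC^T *m P ^t*) 0 i); split.
    by rewrite xpair_eqE oppr_eq0 (negPf Pi0) andbF.
  by rewrite mulrC mulNr subrr.
pose x := a *: uC^T + b *: wC^T.
have uwC : uC^T *m wC = 0 by rewrite map_trmx -map_mxM uw0 map_mx0.
have wuC : wC^T *m uC = 0 by rewrite -[LHS]trmxK trmx_mul trmxK uwC trmx0.
have xJ : x ^t* = a^* *: uC + b^* *: wC.
  apply/colP => k; rewrite !mxE rmorphD !rmorphM/=.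
  by congr (_ * _ + _ * _); apply/CrealP; exact: toC_real.
have nE : (x *m x ^t*) 0 0 =
    `|a| ^+ 2 * (uC^T *m uC) 0 0 + `|b| ^+ 2 * (wC^T *m wC) 0 0.
  rewrite xJ mulmxDl !mulmxDr -!scalemxAl -!scalemxAr uwC wuC !scaler0.
  by rewrite addr0 add0r !scalerA -!normCK !mxE.
have qE : (x *m AC *m x ^t*) 0 0 =
    `|a| ^+ 2 * (mu%:C * (uC^T *m uC) 0 0) +
    `|b| ^+ 2 * (wC^T *m AC *m wC) 0 0.
  have uA : uC^T *m AC = mu%:C *: uC^T.
    by rewrite -[AC]trmxK -trmx_mul map_trmx Asym ACuC linearZ.
  rewrite xJ !mulmxDl -!scalemxAl uA !mulmxDr -!scalemxAl -!scalemxAr.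
  rewrite uwC -[_ *m AC *m uC]mulmxA ACuC -scalemxAr wuC !scaler0.
  by rewrite addr0 add0r !scalerA mulrAC -!normCK !mxE -mulrA.
apply: (spectral_diag_exists_ge AC_herm (x := x)) => //.
(* Pairing [x = 0] with [w] gives [b = 0]; then [a = 0] because [u] is nonzero. *)
- apply: contra_neq ab0 => x0.
  have b0 : b = 0.
    have : (x *m wC) 0 0 = 0 by rewrite x0 mul0mx mxE.
    rewrite mulmxDl -!scalemxAl uwC scaler0 add0r mxE => /eqP.
    rewrite mulf_eq0 => /orP[/eqP//|].
    rewrite gt_eqF// mxE (bigD1 i)//= ltr_pwDl//; last first.
      by rewrite sumr_ge0// => k _; rewrite !mxE -rmorphM lecR mulr_ge0 ?ltW.
    by rewrite !mxE -rmorphM ltcR mulr_gt0.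
  move: x0; rewrite /x b0 scale0r addr0 => /eqP; rewrite scaler_eq0.
  case/orP => [/eqP->//|/eqP/(congr1 trmx)/eqP].
  by rewrite trmxK trmx0 map_mx_eq0 (negPf u_neq0).
- by rewrite mulmxDl -!scalemxAl !mxE in abP *.
rewrite nE qE mulrDr mulrCA lerD2l mulrCA ler_wpM2l ?exprn_ge0//.
rewrite !map_trmx -!map_mxM ![map_mx _ _ 0 0]mxE -rmorphM lecR.
exact: wAw.
Qed.

Theorem spectrum_ones_minus_nonneg : exists rs : seq R, [/\ size rs = n,
  char_poly A = \prod_(r <- rs) ('X - r%:P),
  sorted (fun x y => `|y| <= `|x|) rs & rs`_1 = mu].
Proof.
have n_gt0 : (0 < n)%N.
  by case: (n) u u_neq0 => // v; rewrite flatmx0 eqxx.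
(* The complex diagonalisation has real eigenvalues, so nothing is lost by taking real parts. *)
pose d i := complex.Re (spectral_diag AC 0 i).
have dE i : (d i)%:C = spectral_diag AC 0 i.
  exact/RRe_real/(mxOverP (hermitian_spectral_diag_real AC_herm)).
have [i|i j /AC_pair|i|rs [szrs permrs srs rs1]] :=
    spectrum_arrangement (d := d) (mu := mu) n_gt0.
- by rewrite -lecR dE rmorphN.
- by rewrite -!dE !lecR.
- by have [j ji] := AC_two i; rewrite -dE lecR; exists j.
exists rs; split => //.
apply: (map_poly_inj toC); rewrite map_char_poly char_poly_spectral_diag//.
rewrite (perm_big _ permrs)/= big_map big_enum/= rmorph_prod.
by apply: eq_bigr => i _; rewrite /= map_polyXsubC -dE.
Qed.

End OnesMinusNonnegative.

(** * Cosine sums and the band matrix *)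

(** The sum telescopes: [2 sin t cos((2k+1)t) = sin((2k+2)t) - sin(2kt)]. *)
Lemma sum_cos_odd (R : realType) (t : R) (m : nat) :
  2 * sin t * \sum_(k < m) cos ((2 * k + 1)%:R * t) = sin ((2 * m)%:R * t).
Proof.
elim: m => [|m IHm]; first by rewrite big_ord0 muln0 mul0r mulr0 sin0.
rewrite big_ord_recr/= mulrDr IHm.
have -> : (2 * m)%:R * t = (2 * m + 1)%:R * t - t by rewrite natrD; ring.
have -> : (2 * m.+1)%:R * t = (2 * m + 1)%:R * t + t.
  by rewrite mulnS addnC !natrD; ring.
by rewrite sinB sinD; ring.
Qed.

Section BandMatrix.
Variables (R : realType) (s : nat).
Hypothesis s_gt0 : (0 < s)%N.

Let theta : R := pi / (4 * s + 2)%:R.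
Let mu : R := (2 * sin theta)^-1.

Let den_gt0 : 0 < (4 * s + 2)%:R :> R. Proof. by rewrite ltr0n addnS. Qed.

Let denE : (4 * s + 2)%:R = 4 * s%:R + 2 :> R.
Proof. by rewrite natrD natrM. Qed.

Let theta_gt0 : 0 < theta. Proof. by rewrite divr_gt0 ?pi_gt0. Qed.

Let piE : pi = (4 * s%:R + 2) * theta :> R.
Proof. by rewrite -denE mulrC divfK// gt_eqF. Qed.

Let s_ge1 : 1 <= s%:R :> R. Proof. by rewrite ler1n. Qed.

Let sin_theta_gt0 : 0 < sin theta.
Proof.
by apply: sin_gt0_pi; rewrite theta_gt0/= piE ltr_pMl//; have := s_ge1; lra.
Qed.

Let mu_gt0 : 0 < mu. Proof. by rewrite invr_gt0 mulr_gt0. Qed.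

Let u_halfE k : u_half R s k = cos ((2 * k + 1)%:R * theta).
Proof. by rewrite /u_half mulrA. Qed.

Lemma u_half_gt0 k : (k < s)%N -> 0 < u_half R s k.
Proof.
move=> ks; rewrite u_halfE; apply: cos_gt0_pihalf; rewrite piE.
have : k%:R + 1 <= s%:R :> R by rewrite natr1 ler_nat.
have : 0 <= k%:R :> R by [].
by rewrite natrD natrM; move: theta_gt0; nra.
Qed.

(** Since [pi/2 = (2s+1) theta], the value [sin(2m theta)] of the telescoped sum is
    [cos((2(s-m)+1) theta)]. *)
Lemma sum_u_half m : (m <= s)%N ->
  \sum_(k < m) u_half R s k = mu * u_half R s (s - m).
Proof.
move=> ms; under eq_bigr do rewrite u_halfE.
have sin2_neq0 : 2 * sin theta != 0 by rewrite gt_eqF ?mulr_gt0.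
apply: (mulfI sin2_neq0); rewrite sum_cos_odd [RHS]mulrA /mu mulfV// mul1r u_halfE.
rewrite -cosBpihalf -cosN; congr cos; rewrite piE.
by rewrite natrD !natrM natrB//; field.
Qed.

Let farB : 'M[R]_(2 * s) :=
  \matrix_(i, j) (s <= `|(i : int) - (j : int)|)%N%:R.

Let bandA_ones : bandA R s = const_mx 1 - farB.
Proof.
apply/matrixP => i j; rewrite !mxE.
have -> : (s <= `|(i : int) - (j : int)|)%N =
          ~~ (`|(i : int) - (j : int)| <= s.-1)%N by lia.
by case: ifP => _; rewrite ?subr0 ?subrr.
Qed.

(** Treats both eigenvectors at once: [e = 1] gives the positive [w], [e = -1] gives [u]. *)
Let mirror (e : R) k : R :=
  if (k < s)%N then u_half R s k else e * u_half R s (2 * s - 1 - k).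

Let mirror_rev e k : e ^+ 2 = 1 -> (k < 2 * s)%N ->
  mirror e (2 * s - k.+1) = e * mirror e k.
Proof.
move=> e2 ks; rewrite /mirror; have [k_lt|k_ge] := ltnP k s.
  rewrite ifF; last by apply/negbTE; lia.
  by congr (_ * u_half _ _ _); lia.
rewrite ifT; last by lia.
by rewrite mulrA -expr2 e2 mul1r; congr (u_half _ _ _); lia.
Qed.

(** Row [i] has its ones in the last [s - i] columns if [i < s], and in the first [i + 1 - s]
    columns otherwise. The former are counted from the right end, to suit reflection. *)
Let farB_row (F : nat -> R) (i : 'I_(2 * s)) :
  \sum_j farB i j * F j =
  if (i < s)%N then \sum_(k < s - i) F (2 * s - k.+1)%N
  else \sum_(k < i.+1 - s) F k.
Proof.
have i_lt := ltn_ord i.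
have [i_s|i_s] := ltnP i s.
  rewrite (reindex_inj rev_ord_inj)/=.
  rewrite (big_ord_widen (2 * s) (fun k => F (2 * s - k.+1)%N)); last by lia.
  rewrite [RHS]big_mkcond/=; apply: eq_bigr => j _; rewrite !mxE/=.
  have j_lt := ltn_ord j.
  have -> : (s <= `|(i : int) - (2 * s - j.+1)%N|)%N = (j < s - i)%N by lia.
  by case: ifP => _; rewrite ?mul1r ?mul0r.
rewrite (big_ord_widen (2 * s) F); last by lia.
rewrite [RHS]big_mkcond/=; apply: eq_bigr => j _; rewrite !mxE/=.
have -> : (s <= `|(i : int) - (j : int)|)%N = (j < i.+1 - s)%N.
  have j_lt := ltn_ord j; lia.
by case: ifP => _; rewrite ?mul1r ?mul0r.
Qed.

(** An upper row sums reflected entries, whence the factor [e]. A lower row sums entries of the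
    first half, and there [e * mu * e = mu]. *)
Let farB_mirror e : e ^+ 2 = 1 ->
  farB *m (\col_k mirror e k) = (e * mu) *: \col_k mirror e k.
Proof.
move=> e2; apply/colP => i; rewrite !mxE.
under eq_bigr do rewrite [(\col__ _) _ _]mxE.
rewrite farB_row; have i_lt := ltn_ord i; have [i_s|i_s] := ltnP i s.
  rewrite [in RHS]/mirror i_s -mulrA.
  have -> : u_half R s i = u_half R s (s - (s - i)) by rewrite subKn// ltnW.
  rewrite -sum_u_half ?leq_subr// mulr_sumr; apply: eq_bigr => k _.
  have k_lt := ltn_ord k.
  rewrite mirror_rev//; last by lia.
  by rewrite /mirror ifT//; lia.
rewrite [in RHS]/mirror ltnNge i_s/= mulrACA -expr2 e2 mul1r.
have -> : (2 * s - 1 - i = s - (i.+1 - s))%N by lia.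
rewrite -sum_u_half; last by lia.
apply: eq_bigr => k _; have k_lt := ltn_ord k.
by rewrite /mirror ifT//; lia.
Qed.

Let farB_sym : farB^T = farB.
Proof. by apply/matrixP => i j; rewrite !mxE distnC. Qed.

Let farB_ge0 i j : 0 <= farB i j. Proof. by rewrite mxE ler0n. Qed.

Let vecUE : vecU R s = \col_k mirror (-1) k.
Proof. by apply/colP => k; rewrite !mxE /mirror mulN1r. Qed.

Let mirror1_gt0 k : (k < 2 * s)%N -> 0 < mirror 1 k.
Proof.
by move=> k_lt; rewrite /mirror; case: ltnP => k_s; rewrite ?mul1r u_half_gt0//; lia.
Qed.

Let sum_vecU : \sum_i vecU R s i 0 = 0.
Proof.
rewrite vecUE; under eq_bigr do rewrite mxE.
set S := \sum_i _; suff : S = - S by lra.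
rewrite {1}/S (reindex_inj rev_ord_inj) -sumrN; apply: eq_bigr => i _ /=.
by rewrite mirror_rev ?mulN1r ?sqrrN ?expr1n.
Qed.

(* In each row, [farB] charges at most one of two mirror-image columns. *)
Let mirror_half (i : 'I_(2 * s)) :
  2 * mu * mirror 1 i <= \sum_(j < 2 * s) mirror 1 j.
Proof.
have muE : mu * mirror 1 i = \sum_j farB i j * mirror 1 j.
  have /colP/(_ i) := farB_mirror (expr1n R 2); rewrite !mxE mul1r => <-.
  by apply: eq_bigr => j _; rewrite [(\col__ _) _ _]mxE.
(* One of the two copies of the row sum is reversed, so that columns [j] and [2s-1-j], where [w]
   agrees, are added together. *)
rewrite mulr2n mulrDl mulrDl !mul1r muE [X in X + _](reindex_inj rev_ord_inj)/=.
rewrite -big_split/=; apply: ler_sum => j _.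
rewrite mirror_rev ?expr1n// mul1r -mulrDl.
rewrite ler_piMl ?(ltW (mirror1_gt0 _))// !mxE -natrD lern1/=.
have i_lt := ltn_ord i; have j_lt := ltn_ord j.
by case: (leqP s) => far1; case: (leqP s) => far2 //; lia.
Qed.

Lemma vecU_neq0 : vecU R s != 0.
Proof.
have lt0 : (0 < 2 * s)%N by lia.
apply/eqP => /colP/(_ (Ordinal lt0)); rewrite !mxE s_gt0 => /eqP.
by rewrite gt_eqF ?u_half_gt0.
Qed.

Let farB_vecU : farB *m vecU R s = - mu *: vecU R s.
Proof. by rewrite vecUE farB_mirror ?mulN1r// sqrrN expr1n. Qed.

Lemma bandA_vecU : bandA R s *m vecU R s = (2 * sin theta)^-1 *: vecU R s.
Proof.
rewrite bandA_ones mulmxBl farB_vecU scaleNr opprK -[RHS]add0r; congr (_ + _).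
apply/colP => i; rewrite mxE [RHS]mxE -[RHS]sum_vecU.
by apply: eq_bigr => j _; rewrite mxE mul1r.
Qed.

Lemma bandA_spectrum : exists rs : seq R, [/\ size rs = (2 * s)%N,
  char_poly (bandA R s) = \prod_(r <- rs) ('X - r%:P),
  sorted (fun x y => `|y| <= `|x|) rs & rs`_1 = (2 * sin theta)^-1].
Proof.
rewrite bandA_ones.
apply: (@spectrum_ones_minus_nonneg _ _ _ (\col_k mirror 1 k) (vecU R s)) => //.
- by move=> i; rewrite mxE mirror1_gt0.
- by rewrite farB_mirror ?expr1n// mul1r.
- exact: vecU_neq0.
- move=> i; rewrite mxE; under eq_bigr do rewrite mxE.
  exact: mirror_half.
Qed.

(** The angle is [pi - 2 theta], and [2 - 2 cos(2 theta) = (2 sin theta)^2]. *)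
Lemma bandA_mu_sqrt : (2 * sin theta)^-1 =
  1 / Num.sqrt (2 + 2 * cos ((2 * s)%:R * pi / (2 * s + 1)%:R)) :> R.
Proof.
rewrite div1r; congr (_^-1).
have -> : (2 * s)%:R * pi / (2 * s + 1)%:R = pi - theta *+ 2 :> R.
  rewrite piE natrD natrM; field.
  by have := s_ge1; lra.
rewrite cosB cospi sinpi mul0r addr0 mulN1r cos_mulr2n cos2sin2.
have -> : 2 + 2 * - ((1 - sin theta ^+ 2) *+ 2 - 1) = (2 * sin theta) ^+ 2.
  by ring.
by rewrite sqrtr_sqr gtr0_norm// mulr_gt0.
Qed.

End BandMatrix.

Theorem theorem6 (R : realType) (s : nat) (hs : (1 <= s)%N) :
  exists rs : seq R,
    [/\ size rs = (2 * s)%N,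
        char_poly (bandA R s) = \prod_(r <- rs) ('X - r%:P),
        sorted (fun x y : R => `|y| <= `|x|) rs,
        `|rs`_1| = 1 / Num.sqrt (2 + 2 * cos ((2 * s)%N%:R * pi / (2 * s + 1)%N%:R))
      & (vecU R s != 0 /\ bandA R s *m vecU R s = rs`_1 *: vecU R s)].
Proof.
have [rs [szrs charrs srs rs1]] := bandA_spectrum R hs.
exists rs; split => //.
  by rewrite rs1 bandA_mu_sqrt// ger0_norm// divr_ge0// sqrtr_ge0.
by rewrite rs1; split; [exact: vecU_neq0|exact: bandA_vecU].
Qed.
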